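(* With addition and multiplication of real numbers (minimal rational Cauchy filters), $\mathbb{R}$ is a commutative ring with unity.
   Context: For $q\in\mathbb{Q}$ and rational $\varepsilon>0$ let $q_\varepsilon=\{x\in\mathbb{Q}\mid q-\varepsilon<x<q+\varepsilon\}$. A (rational) filter is a non-empty collection $\mathcal{F}$ of subsets of $\mathbb{Q}$ closed under binary intersections and under supersets (in $\mathbb{Q}$); the improper filter $\mathcal{P}(\mathbb{Q})$ is allowed as a filter. A filter $\mathcal{F}$ is Cauchy if for every rational $\varepsilon>0$ there is $q\in\mathbb{Q}$ with $q_\varepsilon\in\mathcal{F}$. A minimal Cauchy filter is a Cauchy filter $\mathcal{F}$ such that any Cauchy filter $\mathcal{G}\subseteq\mathcal{F}$ satisfies $\mathcal{G}=\mathcal{F}$. In this statement $\mathbb{R}$ denotes the set of all minimal Cauchy filters in $\mathbb{Q}$, and its elements are called real numbers. For $A,B\subseteq\mathbb{Q}$ let $A+B=\{\alpha+\beta\mid\alpha\in A,\beta\in B\}$ and $AB=\{\alpha\beta\mid\alpha\in A,\beta\in B\}$. For real numbers $a,b$, the sum $a+b$ is the collection of all $C\subseteq\mathbb{Q}$ such that $C\supseteq A+B$ for some $A\in a$, $B\in b$; the product $ab$ is the collection of all $C\subseteq\mathbb{Q}$ such that $C\supseteq AB$ for some $A\in a$, $B\in b$. These are regarded as binary operations on $\mathbb{R}$. *)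

(* Defs.v *)
From HB Require Import structures.
From mathcomp Require Import all_boot all_order all_algebra.
From mathcomp Require Import boolp classical_sets filter.
Set Implicit Arguments.
Unset Strict Implicit.
Unset Printing Implicit Defensive.
Import Order.TTheory GRing.Theory Num.Theory.
Local Open Scope classical_set_scope.
Local Open Scope ring_scope.

Definition rat_ball (q e : rat) : set rat := [set x | q - e < x < q + e].

(* [Filter] asks for [F setT], which amounts to non-emptiness given closure
   under supersets; unlike [ProperFilter] it admits the improper filter. *)
Definition cauchy_filter (F : set_system rat) : Prop :=
  Filter F /\ forall e : rat, 0 < e -> exists q : rat, F (rat_ball q e).

Definition minimal_cauchy_filter (F : set_system rat) : Prop :=
  cauchy_filter F /\
  forall G : set_system rat, cauchy_filter G -> G `<=` F -> G = F.

Definition filter_real : Type :=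
  {F : set_system rat | minimal_cauchy_filter F}.

Definition set_add (A B : set rat) : set rat :=
  [set x + y | x in A & y in B].

Definition set_mul (A B : set rat) : set rat :=
  [set x * y | x in A & y in B].

Definition filter_add (a b : set_system rat) : set_system rat :=
  [set C | exists A B : set rat, [/\ a A, b B & set_add A B `<=` C]].

Definition filter_mul (a b : set_system rat) : set_system rat :=
  [set C | exists A B : set rat, [/\ a A, b B & set_mul A B `<=` C]].

(* Main.v *)
Require Import Defs.
From HB Require Import structures.
From mathcomp Require Import all_boot all_order all_algebra.
From mathcomp Require Import boolp classical_sets filter.
From mathcomp Require Import ring lra.
Set Implicit Arguments.
Unset Strict Implicit.
Unset Printing Implicit Defensive.
Import Order.TTheory GRing.Theory Num.Theory.
Local Open Scope classical_set_scope.
Local Open Scope ring_scope.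

(** A Cauchy filter is minimal iff it is proper and round, i.e. each member
    contains the e-neighbourhood of another member for some e > 0. Sums and
    products of round proper Cauchy filters are again such. By minimality each
    ring identity then reduces to one inclusion between the two filters, which
    is an elementwise identity or estimate; for instance, A(B + C) being
    contained in AB + AC yields distributivity. *)

(** * Cauchy filters and neighbourhood filters of rationals *)

Definition round (F : set_system rat) : Prop :=
  forall A, F A -> exists (e : rat) (B : set rat),
    [/\ 0 < e, F B & forall x y : rat, B x -> `|y - x| < e -> A y].

Lemma rat_ballE (q e x : rat) : rat_ball q e x <-> `|x - q| < e.
Proof. by rewrite /rat_ball /= ltr_distl. Qed.

Lemma cauchy_filter_small F (e : rat) : cauchy_filter F -> 0 < e ->
  exists2 A, F A & forall x y : rat, A x -> A y -> `|x - y| < e.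
Proof.
move=> [_ cF] e0; have [|q Fq] := cF (e / 2); first by lra.
exists (rat_ball q (e / 2)) => // x y /rat_ballE hx /rat_ballE hy.
by move: hx hy; rewrite !ltr_norml; lra.
Qed.

(** Any point of a small member serves as the centre of a ball; properness supplies such a point. *)
Lemma small_cauchy_filter F : Filter F -> ~ F set0 ->
  (forall e : rat, 0 < e ->
    exists2 A, F A & forall x y : rat, A x -> A y -> `|x - y| < e) ->
  cauchy_filter F.
Proof.
move=> FF nF0 sF; split=> // e /sF[A FA sA].
have [A0|/set0P[q Aq]] := eqVneq A set0; first by rewrite A0 in FA.
by exists q; apply: filterS FA => x Ax; apply/rat_ballE/sA.
Qed.

Lemma cauchy_filter_bounded F : cauchy_filter F ->
  exists (M : rat) A, [/\ 0 < M, F A & forall x : rat, A x -> `|x| < M].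
Proof.
move=> [_ /(_ 1 ltr01)[q Fq]].
exists (`|q| + 1), (rat_ball q 1); split=> //.
  by have := normr_ge0 q; lra.
move=> x /rat_ballE hx; have := ler_normD (x - q) q.
by rewrite subrK; lra.
Qed.

(** This filter is the rational [q] seen as a real number; [q = 0] and [q = 1] give the neutral
    elements of the ring. *)
Definition nbhs_rat (q : rat) : set_system rat :=
  [set A | exists2 e, 0 < e & rat_ball q e `<=` A].

Lemma nbhs_rat_filter q : Filter (nbhs_rat q).
Proof.
split.
- by exists 1.
- move=> A B [e e0 eA] [d d0 dB]; exists (Order.min e d).
    by rewrite lt_min e0.
  move=> x /rat_ballE; rewrite lt_min => /andP[xe xd].
  by split; [apply: eA|apply: dB]; apply/rat_ballE.
- by move=> A B AB [e e0 eA]; exists e => // x /eA /AB.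
Qed.

Lemma nbhs_rat_singleton {q} {A : set rat} : nbhs_rat q A -> A q.
Proof. by move=> [e e0]; apply; apply/rat_ballE; rewrite subrr normr0. Qed.

Lemma nbhs_rat_cauchy q : cauchy_filter (nbhs_rat q).
Proof. by split; [exact: nbhs_rat_filter|move=> e e0; exists q, e]. Qed.

Lemma nbhs_rat_round q : round (nbhs_rat q).
Proof.
move=> A [e e0 eA]; exists (e / 2), (rat_ball q (e / 2)); split; first by lra.
  by exists (e / 2) => //; lra.
move=> x y /rat_ballE hx hy; apply/eA/rat_ballE.
by move: hx hy; rewrite !ltr_norml; lra.
Qed.

(** * Characterisation of minimal Cauchy filters *)

Lemma minimal_cauchyP F : minimal_cauchy_filter F <->
  [/\ cauchy_filter F, ~ F set0 & round F].
Proof.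
split=> [[cF minF]|[cF nF0 rF]]; last first.
  split=> // G cG GF; apply/seteqP; split=> // A /rF[e [B [e0 FB BA]]].
  have [GG FF] := (cG.1, cF.1).
  have [S GS sS] := cauchy_filter_small cG e0.
  (* The small set [S] meets [B], since both belong to the proper filter [F]; it then lies within
     [e] of a common point, hence inside [A]. *)
  have [SB0|/set0P[x [Sx Bx]]] := eqVneq (S `&` B) set0.
    by case: nF0; rewrite -SB0; apply: filterI => //; exact: GF.
  by apply: filterS GS => y Sy; apply: (BA x) => //; exact: sS.
have FF := cF.1; split=> // [F0|].
  (* An improper [F] contains the Cauchy filter [nbhs_rat 0], so minimality would equate it with a
     proper filter. *)
  have nF : nbhs_rat 0 = F.
    apply: minF; first exact: nbhs_rat_cauchy.
    by move=> A _; apply: filterS F0.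
  by move: F0; rewrite -nF => /nbhs_rat_singleton.
(* [G] collects the sets having room around a member of [F]. It is a Cauchy filter inside [F], so
   minimality gives [G = F]. *)
pose G : set_system rat := [set A | exists (e : rat) (B : set rat),
  [/\ 0 < e, F B & forall x y : rat, B x -> `|y - x| < e -> A y]].
suff <- : G = F.
  move=> A [e [B [e0 FB BA]]].
  (* Halving the room: the e/2-neighbourhood of [B] is in [G], and its own e/2-neighbourhood stays
     in [A]. *)
  exists (e / 2), [set y | exists2 x, B x & `|y - x| < e / 2].
  split; first by lra.
    by exists (e / 2), B; split=> [|//|x y Bx xy]; [lra|exists x].
  move=> y z [x Bx yx] zy; apply: (BA x) => //.
  by move: yx zy; rewrite !ltr_norml; lra.
apply: minF; last first.
  move=> A [e [B [e0 FB BA]]]; apply: filterS FB => x Bx.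
  by apply: (BA x) => //; rewrite subrr normr0.
split; first split.
- by exists 1, setT; split=> //; exact: filterT.
- move=> A A' [e [B [e0 FB BA]]] [e' [B' [e'0 FB' BA']]].
  exists (Order.min e e'), (B `&` B'); split; first by rewrite lt_min e0.
    exact: filterI.
  by move=> x y [Bx B'x]; rewrite lt_min => /andP[? ?]; split;
    [exact: (BA x)|exact: (BA' x)].
- move=> A A' AA' [e [B [e0 FB BA]]]; exists e, B; split=> // x y Bx xy.
  exact/AA'/(BA x).
- move=> e e0; have [|q Fq] := cF.2 (e / 2); first by lra.
  exists q, (e / 2), (rat_ball q (e / 2)); split=> //; first by lra.
  move=> x y /rat_ballE hx hy; apply/rat_ballE.
  by move: hx hy; rewrite !ltr_norml; lra.
Qed.

(** * Elementwise operations on filters *)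

(* [filter_add] and [filter_mul] are convertible to instances of this. *)
Definition filter_op (op : rat -> rat -> rat) (a b : set_system rat) :
    set_system rat :=
  [set C | exists A B : set rat,
    [/\ a A, b B & [set op x y | x in A & y in B] `<=` C]].

Lemma filter_op_filter op a b :
  Filter a -> Filter b -> Filter (filter_op op a b).
Proof.
move=> Fa Fb; split.
- by exists setT, setT; split=> //; exact: filterT.
- move=> C C' [A [B [aA bB AB]]] [A' [B' [aA' bB' AB']]].
  exists (A `&` A'), (B `&` B'); split; [exact: filterI|exact: filterI|].
  move=> _ [x [Ax A'x] [y [By B'y] <-]].
  by split; [apply: AB|apply: AB']; exists x => //; exists y.
- move=> C C' CC' [A [B [aA bB AB]]]; exists A, B; split=> //.
  exact: subset_trans AB CC'.
Qed.

Lemma filter_op_proper op a b : ~ a set0 -> ~ b set0 -> ~ filter_op op a b set0.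
Proof.
move=> na nb [A [B [aA bB AB]]].
have [A0|/set0P[x Ax]] := eqVneq A set0; first by apply: na; rewrite -A0.
have [B0|/set0P[y By]] := eqVneq B set0; first by apply: nb; rewrite -B0.
by apply: (AB (op x y)); exists x => //; exists y.
Qed.

Lemma filter_opC op a b : commutative op ->
  filter_op op a b `<=` filter_op op b a.
Proof.
move=> opC C [A [B [aA bB AB]]]; exists B, A; split=> // _ [y By [x Ax <-]].
by apply: AB; exists x => //; exists y.
Qed.

Lemma filter_opA op a b c : associative op ->
  filter_op op a (filter_op op b c) `<=` filter_op op (filter_op op a b) c.
Proof.
move=> opA D [A [E [aA [B [C [bB cC BC]]] AE]]].
exists [set op x y | x in A & y in B], C; split=> //.
  by exists A, B; split.
move=> _ [_ [x Ax [y By <-]] [z Cz <-]]; apply: AE.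
exists x => //; exists (op y z); last by rewrite opA.
by apply: BC; exists y => //; exists z.
Qed.

(** Each member of [nbhs_rat e] contains [e], so combining it with [B] already yields all of [B]. *)
Lemma filter_op1 op e a : Filter a -> left_id e op ->
  filter_op op (nbhs_rat e) a `<=` a.
Proof.
move=> Fa op1 C [A [B [/nbhs_rat_singleton Ae aB AB]]].
by apply: filterS aB => x Bx; apply: AB; exists e => //; exists x.
Qed.

(** * Minimality of constants, opposites, sums and products *)

Lemma minimal_cauchy_nbhs q : minimal_cauchy_filter (nbhs_rat q).
Proof.
apply/minimal_cauchyP; split; [exact: nbhs_rat_cauchy| |exact: nbhs_rat_round].
by move/nbhs_rat_singleton.
Qed.

Lemma minimal_cauchy_opp a : minimal_cauchy_filter a ->
  minimal_cauchy_filter [set A | a (-%R @^-1` A)].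
Proof.
move=> /minimal_cauchyP[ca na ra]; have Fa := ca.1; apply/minimal_cauchyP.
split=> //; last first.
  move=> A /ra[e [B [e0 aB BA]]]; exists e, (-%R @^-1` B); split=> //=.
    by apply: filterS aB => x Bx /=; rewrite opprK.
  move=> x y Bx xy; rewrite -[y]opprK; apply: (BA (- x)) => //.
  by rewrite -opprD normrN.
split; first split => /=.
- exact: filterT.
- by move=> A B aA aB; apply: filterI.
- by move=> A B AB; apply: filterS => x; apply: AB.
- move=> e /ca.2[q aq]; exists (- q).
  apply: (@filterS _ a _ _ _ _ aq) => x /rat_ballE xq.
  by apply/rat_ballE; rewrite -opprD normrN.
Qed.

Lemma minimal_cauchy_add a b : minimal_cauchy_filter a ->
  minimal_cauchy_filter b -> minimal_cauchy_filter (filter_add a b).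
Proof.
move=> /minimal_cauchyP[ca na ra] /minimal_cauchyP[cb nb rb].
have Fab := filter_op_filter +%R ca.1 cb.1.
have nab := filter_op_proper (op := +%R) na nb.
apply/minimal_cauchyP; split=> //.
  apply: small_cauchy_filter => // e e0; have e20 : 0 < e / 2 by lra.
  have [A aA sA] := cauchy_filter_small ca e20.
  have [B bB sB] := cauchy_filter_small cb e20.
  exists (set_add A B); first by exists A, B; split.
  move=> _ _ [x Ax [y By <-]] [x' Ax' [y' By' <-]].
  have := sA _ _ Ax Ax'; have := sB _ _ By By'.
  by rewrite !ltr_norml; lra.
move=> C [A [B [aA bB AB]]]; have [e [A' [e0 aA' AA']]] := ra _ aA.
exists e, (set_add A' B); split=> //; first by exists A', B; split.
move=> _ z [x A'x [y By <-]] hz; apply: AB.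
(* The whole displacement from [x + y] to [z] is charged to the first summand, so roundness of [a]
   suffices here. *)
exists (z - y); last by exists y => //; rewrite subrK.
by apply: (AA' x) => //; rewrite -addrA -opprD [y + x]addrC.
Qed.

(* If one factor is at least e/4 in absolute value, move the other one.
   Otherwise both neighbourhoods contain the ball of radius 3e/4 around 0,
   and z = (e/2) (2z/e) with |z| < 5e^2/16. *)
Lemma product_neighbourhood (A B : set rat) (e x y z : rat) : 0 < e ->
  (forall u, `|u - x| < e -> A u) -> (forall v, `|v - y| < e -> B v) ->
  `|z - x * y| < e ^+ 2 / 4 -> set_mul A B z.
Proof.
move=> e0 eA eB hz.
have e20 : 0 < e ^+ 2 by rewrite exprn_gt0.
(* Dividing by [s] turns an error below e^2/4 into one below (e^2/4)/(e/4) = e. *)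
have move_factor s t : e / 4 <= `|s| -> `|z - t * s| < e ^+ 2 / 4 ->
    s != 0 /\ `|z / s - t| < e.
  move=> hs hzs; have s0 : 0 < `|s| by lra.
  have sn0 : s != 0 by rewrite -normr_gt0.
  split=> //; have -> : z / s - t = (z - t * s) / s by field.
  rewrite normrM normfV ltr_pdivrMr //; apply: lt_le_trans hzs _.
  by rewrite expr2 -mulrA ler_pM2l.
have [hy|hy] := leP (e / 4) `|y|.
  have [y0 hzy] := move_factor _ _ hy hz.
  exists (z / y); first exact: eA.
  by exists y; [apply: eB; rewrite subrr normr0|rewrite divfK].
have [hx|hx] := leP (e / 4) `|x|.
  rewrite mulrC in hz; have [x0 hzx] := move_factor _ _ hx hz.
  exists x; first by apply: eA; rewrite subrr normr0.
  by exists (z / x); [exact: eB|rewrite mulrC divfK].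
have hxy : `|x * y| <= e ^+ 2 / 16.
  rewrite normrM; have -> : e ^+ 2 / 16 = (e / 4) * (e / 4) by field.
  by apply: ler_pM => //; exact: ltW.
have hz5 : `|z| < e ^+ 2 * (5 / 16).
  by have := ler_normD (z - x * y) (x * y); rewrite subrK; lra.
exists (e / 2).
  by apply: eA; move: hx; rewrite !ltr_norml; lra.
exists (2 * z / e); last by field; lra.
(* The bound on [z] gives 5e/8, and 3e/4 is enough because [y] is within e/4 of 0. *)
have hw : `|2 * z / e| < e * (3 / 4).
  rewrite normrM normfV normrM (gtr0_norm e0) ger0_norm // ltr_pdivrMr //.
  have -> : e * (3 / 4) * e = e ^+ 2 * (3 / 4) by ring.
  by lra.
by apply: eB; move: hw hy; rewrite !ltr_norml; lra.
Qed.

Lemma minimal_cauchy_mul a b : minimal_cauchy_filter a ->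
  minimal_cauchy_filter b -> minimal_cauchy_filter (filter_mul a b).
Proof.
move=> /minimal_cauchyP[ca na ra] /minimal_cauchyP[cb nb rb].
have [Fa Fb] := (ca.1, cb.1).
have Fab := filter_op_filter *%R Fa Fb.
have nab := filter_op_proper (op := *%R) na nb.
apply/minimal_cauchyP; split=> //.
  apply: small_cauchy_filter => // e e0.
  have [M [A [M0 aA bdA]]] := cauchy_filter_bounded ca.
  have [N [B [N0 bB bdB]]] := cauchy_filter_bounded cb.
  (* The two radii make each term of x(y - y') + (x - x')y' smaller than e/2. *)
  have [|A' aA' sA] := @cauchy_filter_small _ (e / (2 * N)) ca.
    by rewrite divr_gt0 ?mulr_gt0.
  have [|B' bB' sB] := @cauchy_filter_small _ (e / (2 * M)) cb.
    by rewrite divr_gt0 ?mulr_gt0.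
  exists (set_mul (A `&` A') (B `&` B')).
    by exists (A `&` A'), (B `&` B'); split=> //; exact: filterI.
  move=> _ _ [x [Ax A'x] [y [By B'y] <-]] [x' [Ax' A'x'] [y' [By' B'y'] <-]].
  have -> : x * y - x' * y' = x * (y - y') + (x - x') * y' by ring.
  apply: le_lt_trans (ler_normD _ _) _; rewrite !normrM.
  have h1 : `|x| * `|y - y'| < M * (e / (2 * M)).
    by apply: ltr_pM => //; [exact: bdA|exact: sB].
  have h2 : `|x - x'| * `|y'| < e / (2 * N) * N.
    by apply: ltr_pM => //; [exact: sA|exact: bdB].
  have E1 : M * (e / (2 * M)) = e / 2 by field; lra.
  have E2 : e / (2 * N) * N = e / 2 by field; lra.
  by rewrite E1 in h1; rewrite E2 in h2; lra.
move=> C [A [B [aA bB AB]]].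
have [e [A' [e0 aA' AA']]] := ra _ aA; have [d [B' [d0 bB' BB']]] := rb _ bB.
have m0 : 0 < Order.min e d by rewrite lt_min e0.
(* [product_neighbourhood] takes a single radius, and the minimum is valid around both factors. *)
exists (Order.min e d ^+ 2 / 4), (set_mul A' B'); split.
- by rewrite divr_gt0 ?exprn_gt0.
- by exists A', B'; split.
move=> _ z [x A'x [y B'y <-]] hz.
apply/AB/(product_neighbourhood m0 _ _ hz) => u; rewrite lt_min => /andP[ue ud].
  exact: (AA' x).
exact: (BB' y).
Qed.

(** * The commutative ring of real numbers *)

HB.instance Definition _ := gen_eqMixin filter_real.
HB.instance Definition _ := gen_choiceMixin filter_real.

(** Minimality of [b] applied to the Cauchy filter [a]; each ring law may thus use whichever
    inclusion is easier. *)
Lemma filter_real_eq (a b : filter_real) : sval a `<=` sval b -> a = b.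
Proof.
case: a b => [F mF] [G mG] /= FG; apply: eq_exist; exact: mG.2 mF.1 FG.
Qed.

Lemma filter_real_filter (a : filter_real) : Filter (sval a).
Proof. exact: (svalP a).1.1. Qed.

Definition real_of_rat (q : rat) : filter_real :=
  exist _ (nbhs_rat q) (minimal_cauchy_nbhs q).
Definition real_opp (a : filter_real) : filter_real :=
  exist _ _ (minimal_cauchy_opp (svalP a)).
Definition real_add (a b : filter_real) : filter_real :=
  exist _ _ (minimal_cauchy_add (svalP a) (svalP b)).
Definition real_mul (a b : filter_real) : filter_real :=
  exist _ _ (minimal_cauchy_mul (svalP a) (svalP b)).

Lemma real_addA : associative real_add.
Proof. by move=> a b c; apply/filter_real_eq/filter_opA/addrA. Qed.

Lemma real_addC : commutative real_add.
Proof. by move=> a b; apply/filter_real_eq/filter_opC/addrC. Qed.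

Lemma real_add0 : left_id (real_of_rat 0) real_add.
Proof.
move=> a; apply: filter_real_eq.
by apply: filter_op1 (filter_real_filter a) (@add0r _).
Qed.

Lemma real_addN : left_inverse (real_of_rat 0) real_opp real_add.
Proof.
move=> a; apply/esym/filter_real_eq => C [e e0 eC].
have Fa := filter_real_filter a.
have [A aA sA] := cauchy_filter_small (svalP a).1 e0.
(* For [-x] and [y] in the small set [A], the sum [x + y] is the difference of two points of [A],
   hence within [e] of 0. *)
exists (-%R @^-1` A), A; split=> //=.
  by apply: filterS aA => x Ax /=; rewrite opprK.
move=> _ [x Ax [y Ay <-]]; apply/eC/rat_ballE.
by rewrite subr0 addrC -[x]opprK; exact: sA.
Qed.

Lemma real_mulA : associative real_mul.
Proof. by move=> a b c; apply/filter_real_eq/filter_opA/mulrA. Qed.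

Lemma real_mulC : commutative real_mul.
Proof. by move=> a b; apply/filter_real_eq/filter_opC/mulrC. Qed.

Lemma real_mul1 : left_id (real_of_rat 1) real_mul.
Proof.
move=> a; apply: filter_real_eq.
by apply: filter_op1 (filter_real_filter a) (@mul1r _).
Qed.

Lemma real_mulDl : left_distributive real_mul real_add.
Proof.
move=> a b c; apply/esym/filter_real_eq => E [S [T [[A [C [aA cC AC]]]]]].
move=> [B [C' [bB cC' BC]]] ST; have Fc := filter_real_filter c.
(* Intersecting [C] and [C'] lets one [z] serve in both products, so (A + B)(C ∩ C') lies in AC +
   BC'. *)
exists (set_add A B), (C `&` C'); split.
- by exists A, B; split.
- exact: filterI.
move=> _ [_ [x Ax [y By <-]] [z [Cz C'z] <-]]; apply: ST.
exists (x * z); first by apply: AC; exists x => //; exists z.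
exists (y * z); last by rewrite mulrDl.
by apply: BC; exists y => //; exists z.
Qed.

HB.instance Definition _ :=
  GRing.isZmodule.Build filter_real real_addA real_addC real_add0 real_addN.
HB.instance Definition _ := GRing.Zmodule_isComPzRing.Build filter_real
  real_mulA real_mulC real_mul1 real_mulDl.

Theorem theorem4p24 :
  exists c : GRing.ComPzRing filter_real,
    let R : comPzRingType := GRing.ComPzRing.Pack c in
    (forall a b : R, sval (a + b) = filter_add (sval a) (sval b)) /\
    (forall a b : R, sval (a * b) = filter_mul (sval a) (sval b)).
Proof. by exists (GRing.ComPzRing.on filter_real). Qed.
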